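(* Assume that $Z_{2n}\stackrel{d}{=}Z_n+I$ for all $n\ge1$, where $I\sim\mathrm{Bernoulli}(1/2)$ is independent of $Z_n$. Then there is a function $\bar G_1:\mathbb{R}\to\mathbb{R}$, periodic with $\bar G_1(x+1)=\bar G_1(x)$ and continuous on $\mathbb{R}\setminus\mathbb{Z}$, such that $\bar G_1(\log_2 n)=\mathbb{E}(Z_n)-\lambda/2$ for all $n\ge1$ and, as $n\to\infty$, $$d_{\mathrm{TV}}(\mathscr{L}(Z_n),\mathscr{L}(Y_\lambda))=\frac{\sqrt{2}\,|\bar G_1(\log_2 n)|}{\sqrt{\pi\log_2 n}}+O\left(\frac{1}{\log n}\right).$$
   Context: Each nonnegative integer is encoded by a different binary string; $\mu(j)$ denotes the number of 1s in the string encoding $j$. For $n\ge1$, $Z_n$ is the random variable $\mu(U_n)$ with $U_n$ uniform on $\{0,1,\ldots,n-1\}$, i.e. $\mathbb{P}(Z_n=k)=\frac1n\#\{0\le j<n:\mu(j)=k\}$. By convention $Z_0=Z_1=0$ (so $\mu(0)=0$). $\lambda=\lfloor\log_2 n\rfloor$, $Y_\lambda\sim\mathrm{Binom}(\lambda,1/2)$, and $d_{\mathrm{TV}}(\mathscr{L}(Z),\mathscr{L}(W))=\frac12\sum_k|\mathbb{P}(Z=k)-\mathbb{P}(W=k)|$. *)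

(* Defs.v *)
From HB Require Import structures.
From mathcomp Require Import all_boot all_order all_algebra.
From mathcomp Require Import all_classical all_reals all_analysis measurable_realfun.
Import Order.TTheory GRing.Theory Num.Theory.
Import numFieldNormedType.Exports.

Set Implicit Arguments.
Unset Strict Implicit.
Unset Printing Implicit Defensive.

Local Open Scope classical_set_scope.
Local Open Scope ring_scope.

Definition log2 {R : realType} (x : R) : R := ln x / ln 2.

(* Integer part of the base-2 logarithm; [Num.truncn] is the floor, as a [nat],
   of a nonnegative number, and [log2 n%:R >= 0] for [n >= 1]. *)
Definition floor_log2 (R : realType) (n : nat) : nat :=
  Num.truncn (log2 (n%:R : R)).

(* Number of 1s in the binary string [enc j], where [true] is the digit 1. *)
Definition num_ones (enc : nat -> seq bool) (j : nat) : nat :=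
  count_mem true (enc j).

Lemma measurable_num_ones (enc : nat -> seq bool) :
  measurable_fun [set: nat] (num_ones enc).
Proof. by []. Qed.

HB.instance Definition _ (enc : nat -> seq bool) :=
  isMeasurableFun.Build _ _ nat nat (num_ones enc) (measurable_num_ones enc).

(* Uniform probability on {0, ..., n-1}.  For [n = 0] the sum is the zero
   measure and [mnormalize] returns its default, the Dirac mass at 0. *)
Definition unif (R : realType) (n : nat) : probability nat R :=
  mnormalize (msum (fun j => \d_j) n) \d_0%N.

(* Law of [Z_n = num_ones enc U_n], with [U_n] uniform on {0, ..., n-1}. *)
Definition lawZ (R : realType) (enc : nat -> seq bool) (n : nat) :
    probability nat R :=
  distribution (unif R n) (num_ones enc).

Definition sum_bool (w : nat * bool) : nat := (w.1 + w.2)%N.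

Lemma measurable_sum_bool : measurable_fun [set: nat * bool] sum_bool.
Proof.
apply: measurable_fun_addn; first exact: measurable_fst.
by apply: (measurableT_comp (f := nat_of_bool)) => //; exact: measurable_snd.
Qed.

HB.instance Definition _ :=
  isMeasurableFun.Build _ _ (nat * bool)%type nat sum_bool measurable_sum_bool.

(* Law of [X + I], for [X] of law [P] and [I] Bernoulli(1/2) independent of [X]:
   independence says that the joint law of [(X, I)] is the product measure. *)
Definition add_bernoulli (R : realType) (P : probability nat R) :
    probability nat R :=
  distribution (P \x bernoulli_prob (2^-1)%R)%E sum_bool.

(* The terms of the series are finite and its sum is at most 2, so that [fine]
   is harmless. *)
Definition dTV (R : realType) (P Q : probability nat R) : R :=
  2^-1 * fine (\sum_(0 <= k <oo) `|P [set k] - Q [set k]|)%E.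

(* Main.v *)
Require Import Defs.
From HB Require Import structures.
From mathcomp Require Import all_boot all_order all_algebra.
From mathcomp Require Import all_classical all_reals all_analysis.
From mathcomp Require Import ring lra zify.
Import Order.TTheory GRing.Theory Num.Theory.
Import numFieldNormedType.Exports.

Set Implicit Arguments.
Unset Strict Implicit.
Unset Printing Implicit Defensive.

Local Open Scope classical_set_scope.
Local Open Scope ring_scope.

(** Write mu(j) for the number of ones of the string of j, and F_n for the sum
    of 'X^(mu j) over j < n. Then F_n / n is the generating polynomial of the
    law of Z_n, h = (1 + 'X) / 2 is that of a fair coin, h ^+ l that of
    Binom(l, 1/2), and the total variation distance of two laws on the naturals
    is half the l1 norm of the difference of their generating polynomials.

    The hypothesis says F_(2n) = (1 + 'X) * F_n. Comparing n with n + 1 gives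
    {mu(2n), mu(2n+1)} = {mu(n), mu(n) + 1} as multisets. Hence mu(n) is at most
    the number of binary digits of n, and F_(2n+1) = (1 + 'X) * F_n + 'X^a with
    a = mu(2n).

    Distance. Let 2^l <= n < 2^(l+1), let M_n be the sum of mu(j) over j < n,
    and A_n = M_n - n l / 2 the excess, so that A_n / n = E(Z_n) - l / 2.
    Expanding at 'X = 1 to first order,
      F_n / n - h ^+ l = (A_n / n) ('X - 1) h ^+ l + error.
    Scale the error by n / 2^l, and read the binary digits of n from the left:
    the scaled error is 0 after the leading digit, each further digit multiplies
    it by h, and a digit 1 at place k after the leading one adds 2^-k times
      'X^a - h ^+ k - (a - k / 2) ('X - 1) h ^+ k.
    The latter has a double zero at 1, and its quotient by ('X - 1)^2 has norm
    O(k^2) (lemma l1norm_taylor). Moreover ('X - 1) h ^+ q has norm twice the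
    largest weight of Binom(q, 1/2), which is O(q^(-1/2)); since the l1 norm is
    submultiplicative, ('X - 1)^2 h ^+ m has norm O(1 / m). The geometric factors
    2^-k make the contributions of all digits add up to O(1 / l) (lemma
    l1norm_first_order). Half the norm of the main term is |A_n / n| times the
    largest weight of Binom(l, 1/2). Wallis' inequalities put this weight within
    O(1 / l) of sqrt 2 / sqrt (pi log2 n) (lemma mode_mass_asymp), and A_n / n is
    bounded (lemma excess_bound).

    Periodic function. Since A_(2n) = 2 A_n, the number A_n / 2^l depends only on
    t = n / 2^l. For real t, take n = floor(2^k t) and l = k: consecutive values
    of k change A_n / 2^k by O(k / 2^k), so there is a limit, uniform in t. It is
    continuous because A_(n+1) - A_n = O(k). The function of the statement is
    this limit divided by t, at t = 2^(x - floor x); continuity can only fail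
    where floor jumps. *)

(** * The l1 norm of polynomials *)

Definition l1norm {R : numDomainType} (p : {poly R}) : R := \sum_(c <- p) `|c|.

Section L1norm.
Context {R : numDomainType}.
Implicit Types p q : {poly R}.

Lemma l1normE n p : (size p <= n)%N -> l1norm p = \sum_(i < n) `|p`_i|.
Proof.
move=> pn; rewrite /l1norm (big_nth 0) -(big_mkord xpredT (fun i => `|p`_i|)).
rewrite [RHS](big_cat_nat _ pn)//= [X in _ = _ + X]big_nat_cond [X in _ = _ + X]big1 ?addr0//.
by move=> i /andP[/andP[pi _] _]; rewrite nth_default// normr0.
Qed.

Lemma l1norm0 : l1norm (0 : {poly R}) = 0.
Proof. by rewrite (@l1normE 0) ?big_ord0// size_poly0. Qed.

Lemma l1norm_ge0 p : 0 <= l1norm p.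
Proof. exact: sumr_ge0. Qed.

Lemma l1normD p q : l1norm (p + q) <= l1norm p + l1norm q.
Proof.
rewrite (@l1normE (maxn (size p) (size q))) ?size_polyD//.
rewrite (@l1normE _ p (leq_maxl _ (size q))) (@l1normE _ q (leq_maxr (size p) _)).
by rewrite -big_split ler_sum// => i _; rewrite coefD ler_normD.
Qed.

Lemma l1normZ a p : l1norm (a *: p) = `|a| * l1norm p.
Proof.
rewrite (@l1normE (size p)) ?size_scale_leq// (@l1normE (size p))// mulr_sumr.
by apply: eq_bigr => i _; rewrite coefZ normrM.
Qed.

Lemma l1normN p : l1norm (- p) = l1norm p.
Proof. by rewrite -scaleN1r l1normZ normrN1 mul1r. Qed.

Lemma l1normB p q : l1norm (p - q) <= l1norm p + l1norm q.
Proof. by rewrite -[l1norm q]l1normN l1normD. Qed.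

Lemma l1normMX p : l1norm (p * 'X) = l1norm p.
Proof.
have [->|p0] := eqVneq p 0; first by rewrite mul0r.
by rewrite /l1norm polyseqMX// big_cons normr0 add0r.
Qed.

Lemma l1normC (c : R) : l1norm c%:P = `|c|.
Proof.
by rewrite (@l1normE 1) ?size_polyC ?leq_b1// big_ord_recl big_ord0 coefC/= addr0.
Qed.

Lemma l1normMXaddC p (c : R) : l1norm (p * 'X + c%:P) = l1norm p + `|c|.
Proof.
rewrite (@l1normE (size p).+1); last first.
  rewrite (leq_trans (size_polyD _ _))// geq_max size_polyC.
  rewrite (leq_trans (leq_b1 _))// andbT (leq_trans (size_polyMleq _ _))//.
  by rewrite size_polyX addn2.
rewrite big_ord_recl coefD coefMX coefC /= add0r addrC; congr (_ + _).
rewrite (@l1normE (size p))//.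
by apply: eq_bigr => i _; rewrite coefD coefMX coefC /= addr0.
Qed.

Lemma l1normM p q : l1norm (p * q) <= l1norm p * l1norm q.
Proof.
elim/poly_ind: p => [|p c IH]; first by rewrite mul0r l1norm0 mul0r.
rewrite l1normMXaddC !mulrDl (le_trans (l1normD _ _))//.
by rewrite -mulrA ['X * q]mulrC mulrA l1normMX mul_polyC l1normZ lerD.
Qed.

Lemma l1norm1 : l1norm (1 : {poly R}) = 1.
Proof. by rewrite -polyC1 l1normC normr1. Qed.

Lemma l1normX : l1norm ('X : {poly R}) = 1.
Proof. by rewrite -['X]mul1r l1normMX l1norm1. Qed.

Lemma l1normX_le1 p n : l1norm p <= 1 -> l1norm (p ^+ n) <= 1.
Proof.
move=> p1; elim: n => [|n IH]; first by rewrite expr0 l1norm1.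
by rewrite exprS (le_trans (l1normM _ _))// mulr_ile1// l1norm_ge0.
Qed.

(** The coefficients of ('X - 1) * p are the differences of consecutive
    coefficients of p. *)
Lemma l1norm_BX1M p n : (size p <= n)%N ->
  l1norm (('X - 1) * p) = `|p`_0| + \sum_(i < n) `|p`_i - p`_i.+1|.
Proof.
move=> pn; rewrite (@l1normE n.+1); last first.
  rewrite (leq_trans (size_polyMleq _ _))// -polyC1 size_XsubC.
  by rewrite add2n.
rewrite big_ord_recl; congr (_ + _).
  by rewrite mulrBl mul1r ['X * _]mulrC coefB coefMX/= sub0r normrN.
by apply: eq_bigr => i _; rewrite mulrBl mul1r ['X * _]mulrC coefB coefMX/=.
Qed.

(** Taylor's formula at p = 1 with an explicit remainder: from p ^+ a to
    p ^+ a.+1 the quotient is multiplied by p, which does not increase its norm,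
    and gains a constant. *)
Lemma exp_taylor1 p a : l1norm p <= 1 ->
  exists2 q, p ^+ a = 1 + (p - 1) * q & l1norm q <= a%:R.
Proof.
move=> p1; elim: a => [|a [q E qa]].
  by exists 0; rewrite ?l1norm0// mulr0 addr0 expr0.
exists (p * q + 1); first by rewrite exprS E; ring.
rewrite (le_trans (l1normD _ _))// l1norm1 -natr1 lerD2r.
by rewrite (le_trans (l1normM _ _))// (le_trans _ qa)// ler_piMl// l1norm_ge0.
Qed.

Lemma exp_taylor2 p a : l1norm p <= 1 ->
  exists2 q, p ^+ a = 1 + a%:R *: (p - 1) + (p - 1) ^+ 2 * q & l1norm q <= a%:R ^+ 2.
Proof.
move=> p1; elim: a => [|a [q E qa]].
  by exists 0; rewrite ?l1norm0 ?expr0n// mulr0 addr0 expr0 scale0r addr0.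
exists (p * q + a%:R%:P).
  by rewrite exprS E -!mul_polyC -natr1 polyCD polyC1; ring.
rewrite (le_trans (l1normD _ _))// l1normC normr_nat.
have -> : a.+1%:R ^+ 2 = a%:R ^+ 2 + (a%:R + a%:R + 1) :> R.
  by rewrite -natr1; ring.
apply: lerD; last by rewrite -addrA lerDl addr_ge0.
by rewrite (le_trans (l1normM _ _))// (le_trans _ qa)// ler_piMl// l1norm_ge0.
Qed.

End L1norm.

(** The sum telescopes on each side of the mode. *)
Lemma unimodal_variation {R : numDomainType} (f : nat -> R) (m n : nat) :
  (forall i, (i < m)%N -> f i <= f i.+1) ->
  (forall i, (m <= i)%N -> f i.+1 <= f i) -> (m <= n)%N ->
  \sum_(i < n) `|f i - f i.+1| = 2 * f m - f 0%N - f n.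
Proof.
move=> up down mn.
rewrite -(big_mkord xpredT (fun i => `|f i - f i.+1|)) (big_cat_nat _ mn)//=.
rewrite (_ : \sum_(0 <= i < m) _ = f m - f 0%N); last first.
  rewrite -telescope_sumr//; apply: eq_big_nat => i /andP[_ im].
  by rewrite distrC ger0_norm// subr_ge0 up.
rewrite (_ : \sum_(m <= i < n) _ = f m - f n); last first.
  rewrite -[RHS]opprB -telescope_sumr// -sumrN; apply: eq_big_nat => i /andP[mi _].
  by rewrite opprB ger0_norm// subr_ge0 down.
by ring.
Qed.

(** * Central binomial coefficients and Wallis' product *)

(** The reduction formula for the integral of cos ^+ n, taken as a definition:
    Wallis' argument then uses derivatives only. *)
Fixpoint cos_power_primitive {R : realType} (n : nat) (x : R) : R :=
  match n with
  | 0 => x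
  | 1 => sin x
  | m.+2 => (cos x ^+ m.+1 * sin x + m.+1%:R * cos_power_primitive m x) / m.+2%:R
  end.

Lemma is_derive_cos_power_primitive {R : realType} (n : nat) (x : R) :
  is_derive x 1 (cos_power_primitive n) (cos x ^+ n).
Proof.
elim/ltn_ind: n x => -[|[|n]] IH x.
- rewrite expr0; exact: is_derive_id.
- rewrite expr1; exact: is_derive_sin.
have H := IH n (leqW (leqnn _)) x.
have -> : cos_power_primitive n.+2 =
  n.+2%:R^-1 *: (cos ^+ n.+1 * sin + n.+1%:R *: cos_power_primitive n :> (R -> R)).
  by apply/funext => y; rewrite [LHS]/= [LHS]mulrC !fctE.
have hM := is_deriveM (is_deriveX n.+1 (is_derive_cos x)) (is_derive_sin x).
apply: (is_derive_eq (is_deriveZ n.+2%:R^-1 (is_deriveD hM (is_deriveZ n.+1%:R H)))).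
rewrite /GRing.scale /= !fctE /=.
have n2 : n.+2%:R != 0 :> R by rewrite pnatr_eq0.
apply: (mulfI n2); rewrite mulVKf//.
have s2 : sin x * sin x = 1 - cos x ^+ 2 by rewrite -(cos2Dsin2 x); ring.
transitivity (cos x ^+ n.+1 * cos x + n.+1%:R * cos x ^+ n * (1 - sin x * sin x)).
  ring.
by rewrite s2 -(natr1 n.+1) !exprS; ring.
Qed.

Lemma cos_power_primitive0 {R : realType} (n : nat) : cos_power_primitive n 0 = 0 :> R.
Proof.
elim/ltn_ind: n => -[|[|n]] IH //=; first exact: sin0.
by rewrite IH // sin0 !mulr0 addr0 mul0r.
Qed.

(** The integral of cos ^+ n over [0, pi / 2]. *)
Definition wallis {R : realType} (n : nat) : R := cos_power_primitive n (pi / 2).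

Lemma wallis1 {R : realType} : wallis 1 = 1 :> R. Proof. exact: sin_pihalf. Qed.

Lemma wallisSS {R : realType} (n : nat) :
  wallis n.+2 = n.+1%:R / n.+2%:R * wallis n :> R.
Proof. by rewrite /wallis /= cos_pihalf expr0n mul0r add0r mulrAC. Qed.

(** cos ^+ n.+1 <= cos ^+ n on [0, pi / 2], and the primitives agree at 0. *)
Lemma wallis_decr {R : realType} (n : nat) : wallis n.+1 <= wallis n :> R.
Proof.
pose f : R -> R := cos_power_primitive n - cos_power_primitive n.+1.
have p0 : 0 <= pi / 2 :> R by rewrite ltW // divr_gt0 ?pi_gt0.
have df (x : R) : is_derive x 1 f (cos x ^+ n - cos x ^+ n.+1).
  have h1 := is_derive_cos_power_primitive n x; have h2 := is_derive_cos_power_primitive n.+1 x.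
  exact: is_deriveB.
have cf : {within `[0, (pi / 2)], continuous f}.
  apply: continuous_subspaceT => x; apply: differentiable_continuous.
  apply/derivable1_diffP; exact: (@ex_derive _ _ _ _ _ _ _ (df x)).
have [c + ] := MVT_segment p0 (fun x _ => df x) cf.
rewrite in_itv /= => /andP[c0 cp].
rewrite /f !fctE !cos_power_primitive0 !subr0 => E.
rewrite -subr_ge0 [_ - _]E mulr_ge0 // exprS subr_ge0.
rewrite ler_piMl ?cos_le1// exprn_ge0// cos_ge0_pihalf// cp andbT.
by rewrite (le_trans _ c0)// oppr_le0.
Qed.

Definition central_mass {R : realType} (m : nat) : R := 'C(m.*2, m)%:R / 4 ^+ m.

Lemma bin_double (m : nat) : (m.+1 * 'C(m.*2.+2, m.+1) = (m.*2.+1).*2 * 'C(m.*2, m))%N.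
Proof.
have h1 := mul_bin_diag (m.*2.+2) m.
have h2 := mul_bin_down (m.*2.+1) m.
rewrite /= in h1 h2.
have e : (m.*2.+1 - m = m.+1)%N by lia.
rewrite e in h2; nia.
Qed.

Lemma central_massS {R : realType} (m : nat) :
  central_mass m.+1 = m.*2.+1%:R / m.*2.+2%:R * central_mass m :> R.
Proof.
have := congr1 (fun k => k%:R : R) (bin_double m).
rewrite /central_mass doubleS exprS !natrM => h.
have m1 : (m.+1%:R : R) != 0 by rewrite pnatr_eq0.
have m2 : (m.*2.+2%:R : R) != 0 by rewrite pnatr_eq0.
have m4 : (4 ^+ m : R) != 0 by rewrite expf_neq0 ?pnatr_eq0.
have -> : ('C(m.*2.+2, m.+1)%:R : R) = (m.*2.+1).*2%:R * 'C(m.*2, m)%:R / m.+1%:R.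
  by rewrite -h mulrAC mulfV ?mul1r.
rewrite -doubleS -!muln2 !natrM in m2 *.
by field; rewrite m4 nat1r m1.
Qed.

Lemma central_mass_ge0 {R : realType} (m : nat) : 0 <= central_mass m :> R.
Proof. by rewrite divr_ge0 ?exprn_ge0. Qed.

Lemma wallis_even {R : realType} (m : nat) : wallis m.*2 = central_mass m * (pi / 2) :> R.
Proof.
elim: m => [|m IH]; first by rewrite /central_mass bin0 expr0 divr1 mul1r.
by rewrite doubleS wallisSS IH central_massS -[RHS]mulrA.
Qed.

Lemma wallis_odd {R : realType} (m : nat) :
  wallis m.*2.+1 * (m.*2.+1%:R * central_mass m) = 1 :> R.
Proof.
elim: m => [|m IH]; first by rewrite wallis1 /central_mass bin0 expr0 !mul1r invr1.
rewrite -[RHS]IH doubleS wallisSS central_massS; field.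
by rewrite -!natrD !pnatr_eq0.
Qed.

(** This is wallis m.*2.+1 <= wallis m.*2, both sides being expressed through
    the central mass. *)
Lemma central_mass_lb {R : realType} (m : nat) : 1 <= pi * (m%:R + 2^-1) * central_mass m ^+ 2 :> R.
Proof.
have h := wallis_decr (R := R) m.*2.
have c0 := central_mass_ge0 (R := R) m.
rewrite -[leLHS](wallis_odd m).
have := ler_wpM2r (mulr_ge0 (ler0n R m.*2.+1) c0) h.
move=> /le_trans; apply.
rewrite wallis_even -(natr1 m.*2) -muln2 natrM le_eqVlt; apply/orP; left.
by apply/eqP; field.
Qed.

(** This is wallis m.*2 <= wallis m.*2.-1, in the same way. *)
Lemma central_mass_ub {R : realType} (m : nat) : pi * m%:R * central_mass m ^+ 2 <= 1 :> R.
Proof.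
case: m => [|m]; first by rewrite mulr0 mul0r.
have h := wallis_decr (R := R) m.*2.+1.
have c0 := central_mass_ge0 (R := R) m.+1.
rewrite -[leRHS](wallis_odd m).
have e : m.*2.+1%:R * central_mass m = 2 * m.+1%:R * central_mass m.+1 :> R.
  rewrite central_massS -doubleS -(muln2 m.+1) natrM; field.
  by rewrite nat1r pnatr_eq0.
rewrite e; apply: le_trans (ler_wpM2r _ h); last by rewrite !mulr_ge0.
rewrite -doubleS wallis_even le_eqVlt; apply/orP; left.
by apply/eqP; field.
Qed.

(** Weaker than central_mass_ub for large m, but it still gives information at
    m = 0, where the previous bound is void. *)
Lemma central_mass_crude {R : realType} (m : nat) : m.*2.+1%:R * central_mass m ^+ 2 <= 1 :> R.
Proof.
elim: m => [|m IH]; first by rewrite /central_mass bin0 expr0 divr1 expr1n mulr1.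
apply: le_trans IH.
rewrite central_massS exprMn mulrA ler_wpM2r ?sqr_ge0//.
rewrite expr_div_n mulrA ler_pdivrMr ?exprn_gt0//.
rewrite -!natrX -!natrM ler_nat; lia.
Qed.

(** The largest weight of Binom(q, 1/2). *)
Definition mode_mass {R : realType} (q : nat) : R := 'C(q, uphalf q)%:R / 2 ^+ q.

(** One formula serves both parities, because
    'C(2m, m) = 2 * 'C(2m - 1, m). *)
Lemma mode_massE {R : realType} (q : nat) : mode_mass q = central_mass (uphalf q) :> R.
Proof.
rewrite /mode_mass /central_mass.
have -> : 4 = 2 ^+ 2 :> R by ring.
rewrite -exprM mul2n.
have [qodd|qeven] := boolP (odd q); last first.
  have -> : (uphalf q).*2 = q by lia.
  by [].
have -> : (uphalf q).*2 = q.+1 by lia.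
have := mul_bin_down q.+1 (uphalf q).
rewrite /=.
have -> : (q.+1 - uphalf q = uphalf q)%N by lia.
have e : (q.+1 = (uphalf q).*2)%N by lia.
rewrite {1}e -mul2n -mulnA mulnCA => /eqP.
rewrite eqn_pmul2l; last by lia.
move=> /eqP h; rewrite -h natrM exprS; field.
by rewrite expf_neq0 ?pnatr_eq0.
Qed.

Lemma mode_mass_ge0 {R : realType} (q : nat) : 0 <= mode_mass q :> R.
Proof. by rewrite mode_massE central_mass_ge0. Qed.

Lemma mode_mass_crude {R : realType} (q : nat) : q.+1%:R * mode_mass q ^+ 2 <= 1 :> R.
Proof.
apply: le_trans (central_mass_crude (uphalf q)); rewrite mode_massE ler_wpM2r ?sqr_ge0//.
by rewrite ler_nat; lia.
Qed.

Lemma mode_mass_lb {R : realType} (q : nat) : 2 <= pi * (q%:R + 2) * mode_mass q ^+ 2 :> R.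
Proof.
rewrite mode_massE; have h := central_mass_lb (R := R) (uphalf q).
have p0 := pi_ge0 R.
have := sqr_ge0 (central_mass (R := R) (uphalf q)).
have : (uphalf q)%:R * 2 <= q%:R + 1 :> R.
  by rewrite natr1 -natrM ler_nat; lia.
move: h; set u := (uphalf q)%:R; set b := _ ^+ 2 => h uq b0.
have : 0 <= pi * b * (q%:R + 1 - u * 2) by rewrite !mulr_ge0// subr_ge0.
by move=> k; lra.
Qed.

Lemma mode_mass_ub {R : realType} (q : nat) : pi * q%:R * mode_mass q ^+ 2 <= 2 :> R.
Proof.
rewrite mode_massE; have h := central_mass_ub (R := R) (uphalf q).
have p0 := pi_ge0 R.
have := sqr_ge0 (central_mass (R := R) (uphalf q)).
have : q%:R <= (uphalf q)%:R * 2 :> R.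
  by rewrite -natrM ler_nat; lia.
move: h; set u := (uphalf q)%:R; set b := _ ^+ 2 => h uq b0.
have : 0 <= pi * b * (u * 2 - q%:R) by rewrite !mulr_ge0// subr_ge0.
by move=> k; lra.
Qed.

(** * Powers of the generating polynomial of a fair coin *)

(** Generating polynomial of the Bernoulli(1/2) law. *)
Definition coin {R : realType} : {poly R} := 2^-1 *: (1 + 'X).

Section Coin.
Context {R : realType}.
Local Notation h := (@coin R).

Lemma coin_sub1 : h - 1 = 2^-1 *: ('X - 1).
Proof.
rewrite /coin scalerDr scalerBr.
have e : 1 = 2^-1 *: 1 + 2^-1 *: 1 :> {poly R}.
  by rewrite -scalerDl -[RHS]mul_polyC -polyC1 -polyCM; congr (_%:P); lra.
by rewrite {2}e; ring.
Qed.

Lemma l1norm_coin : l1norm h <= 1.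
Proof.
rewrite l1normZ (le_trans (ler_wpM2l _ (l1normD _ _)))// l1norm1 l1normX.
rewrite ger0_norm//; lra.
Qed.

Lemma l1norm_coinX m : l1norm (h ^+ m) <= 1.
Proof. exact/l1normX_le1/l1norm_coin. Qed.

Lemma coef_1DXn (q i : nat) : ((1 + 'X) ^+ q : {poly R})`_i = 'C(q, i)%:R.
Proof.
elim: q i => [|q IH] i; first by rewrite expr0 coef1 bin0n.
rewrite exprSr mulrDr mulr1 coefD coefMX !IH.
by case: i => [|i]; rewrite /= ?addr0 ?bin0// binS natrD.
Qed.

Lemma coef_coinX (q i : nat) : (h ^+ q)`_i = 'C(q, i)%:R / 2 ^+ q.
Proof. by rewrite exprZn coefZ coef_1DXn exprVn mulrC. Qed.

Lemma size_coinX q : (size (h ^+ q) <= q.+1)%N.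
Proof.
by apply/leq_sizeP => i qi; rewrite coef_coinX bin_small ?mul0r.
Qed.

Lemma bin_le_up (q i : nat) : (i < uphalf q)%N -> ('C(q, i) <= 'C(q, i.+1))%N.
Proof.
move=> iq; have := mul_bin_left q i.
have : (i.+1 <= q - i)%N by lia.
move=> le eqn; rewrite -(leq_pmul2l (ltn0Sn i)) eqn; exact: leq_mul.
Qed.

Lemma bin_le_down (q i : nat) : (uphalf q <= i)%N -> ('C(q, i.+1) <= 'C(q, i))%N.
Proof.
move=> iq; have := mul_bin_left q i.
have : (q - i <= i.+1)%N by lia.
move=> le eqn; rewrite -(leq_pmul2l (ltn0Sn i)) eqn; exact: leq_mul.
Qed.

(** The weights of Binom(q, 1/2) increase up to uphalf q and decrease
    afterwards, so the total variation of their sequence is twice the maximum. *)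
Lemma l1norm_diff_coinX q : l1norm (('X - 1) * h ^+ q) = 2 * mode_mass q.
Proof.
rewrite (l1norm_BX1M (size_coinX q)).
rewrite (@unimodal_variation _ (fun i => (h ^+ q)`_i) (uphalf q)).
- rewrite !coef_coinX ger0_norm ?divr_ge0 ?exprn_ge0//.
  by rewrite (bin_small (ltnSn q)) mul0r subr0 addrC subrK.
- by move=> i iq; rewrite !coef_coinX ler_wpM2r ?invr_ge0 ?exprn_ge0// ler_nat bin_le_up.
- by move=> i iq; rewrite !coef_coinX ler_wpM2r ?invr_ge0 ?exprn_ge0// ler_nat bin_le_down.
- by lia.
Qed.

(** Split h ^+ m into two equal powers, up to a factor of norm at most 1, and
    give one factor 'X - 1 to each: both halves have norm O(m^(-1/2)). *)
Lemma l1norm_diff2_coinX m : l1norm (('X - 1) ^+ 2 * h ^+ m) <= 8 / m.+1%:R.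
Proof.
pose q := m./2.
have -> : ('X - 1) ^+ 2 * h ^+ m =
    (('X - 1) * h ^+ q) * (('X - 1) * h ^+ q) * h ^+ odd m.
  have -> : h ^+ m = h ^+ odd m * h ^+ q * h ^+ q.
    by rewrite -!exprD -addnA addnn odd_double_half.
  by ring.
rewrite (le_trans (l1normM _ _))//.
rewrite (le_trans (ler_piMr (l1norm_ge0 _) (l1norm_coinX _)))//.
rewrite (le_trans (l1normM _ _))// l1norm_diff_coinX.
have := mode_mass_crude (R := R) q.
rewrite ler_pdivlMr// => c.
have : m.+1%:R <= 2 * q.+1%:R :> R by rewrite -natrM ler_nat /q; lia.
have b0 := sqr_ge0 (mode_mass (R := R) q).
move=> mq; have := ler_wpM2l b0 mq; lra.
Qed.

(** 'X^a and h ^+ k have value 1 and slopes a and k / 2 at 'X = 1, so the left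
    side has a double zero there. The condition on a is what the doubling
    relation provides when a = mu (2 * n) and n < 2 ^ k. *)
Lemma l1norm_taylor (a k : nat) : (a <= k.+1)%N -> exists2 S : {poly R},
  'X^a - h ^+ k - (a%:R - k%:R / 2) *: (('X - 1) * h ^+ k) = ('X - 1) ^+ 2 * S
  & l1norm S <= 2 * k.+1%:R ^+ 2.
Proof.
move=> ak.
have lX : l1norm ('X : {poly R}) <= 1 by rewrite l1normX.
have [q1 E1 n1] := exp_taylor2 a lX.
have [q2 E2 n2] := exp_taylor2 k l1norm_coin.
have [q3 E3 n3] := exp_taylor1 k l1norm_coin.
exists (q1 - 4^-1 *: q2 - ((a%:R - k%:R / 2) / 2) *: q3).
  rewrite {2}E3 E1 E2 coin_sub1 -!mul_polyC.
  have -> : (4^-1 : R) = 2^-1 * 2^-1 by lra.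
  by rewrite !(polyCM, polyCB); ring.
rewrite (le_trans (l1normB _ _))//.
rewrite (le_trans (lerD (l1normB _ _) (lexx _)))// !l1normZ.
have ak' : a%:R <= k%:R + 1 :> R by rewrite natr1 ler_nat.
have a0 : 0 <= a%:R :> R by [].
have k0 : 0 <= k%:R :> R by [].
have : `|a%:R - k%:R / 2| <= k%:R / 2 + 1 :> R by rewrite ler_norml; apply/andP; split; lra.
rewrite normrM !(@ger0_norm _ (_^-1)) ?invr_ge0//.
move=> n4; have := ler_pM (normr_ge0 _) (l1norm_ge0 _) n4 n3.
have : a%:R ^+ 2 <= (k%:R + 1) ^+ 2 :> R by rewrite ler_sqr// nnegrE addr_ge0.
by move=> ? ?; have := mulr_ge0 k0 k0; rewrite -(natr1 k); lra.
Qed.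

End Coin.

(** * Generating polynomials under doubling *)

Definition gen_poly {R : realType} (mu : nat -> nat) (n : nat) : {poly R} :=
  \sum_(j < n) 'X^(mu j).

Definition total_ones (mu : nat -> nat) (n : nat) : nat := \sum_(j < n) mu j.

Definition excess {R : realType} (mu : nat -> nat) (l n : nat) : R :=
  (total_ones mu n)%:R - n%:R * (l%:R / 2).

(** Bounds the contributions to the error of the l digits that follow the leading
    one, up to a common factor (see l1norm_block). *)
Definition cube_sum {R : realType} (l : nat) : R :=
  \sum_(k < l) k.+2%:R ^+ 3 / 2 ^+ k.+1.

Lemma cube_sumS {R : realType} (l : nat) :
  cube_sum l.+1 = cube_sum l + l.+2%:R ^+ 3 / 2 ^+ l.+1 :> R.
Proof. by rewrite /cube_sum big_ord_recr. Qed.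

Lemma cube_sum_le {R : realType} (l : nat) : cube_sum l <= 51 :> R.
Proof.
(* p solves 2 p(k) - p(k + 1) = (k + 2)^3, so that the terms of cube_sum are the
   differences of p(k) / 2^k. *)
pose p (k : R) := k ^+ 3 + 9 * k ^+ 2 + 33 * k + 51.
have -> : cube_sum l = 51 - p l%:R / 2 ^+ l.
  elim: l => [|l IH].
    by rewrite /cube_sum big_ord0 /p !expr0n /= !mulr0 !add0r expr0 divr1 subrr.
  rewrite cube_sumS IH /p (exprS 2) -(natr1 l.+1) -(natr1 l); field.
  by rewrite expf_neq0.
rewrite lerBlDr lerDl divr_ge0 ?exprn_ge0// /p.
by rewrite !addr_ge0 ?mulr_ge0 ?exprn_ge0.
Qed.

Section Doubling.
Context {R : realType} (mu : nat -> nat).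
Local Notation F := (@gen_poly R mu).
Local Notation h := (@coin R).
Hypothesis F_double : forall n, F (2 * n) = (1 + 'X) * F n.

Lemma gen_polyS n : F n.+1 = F n + 'X^(mu n).
Proof. by rewrite /gen_poly big_ord_recr. Qed.

(** The difference of the doubling relation at n.+1 and at n. *)
Lemma mu_double n :
  'X^(mu (2 * n)%N) + 'X^(mu (2 * n).+1) = (1 + 'X) * 'X^(mu n) :> {poly R}.
Proof.
apply: (@addrI _ ((1 + 'X) * F n)).
rewrite -mulrDr -gen_polyS -!F_double addrA -!gen_polyS; congr F; lia.
Qed.

(** Comparing coefficients: the pair of values of mu at 2 * n and (2 * n).+1 is
    a permutation of mu n, (mu n).+1. *)
Lemma mu_double_coef n k :
  ((k == mu (2 * n)) + (k == mu (2 * n).+1) = (k == mu n) + (k == (mu n).+1))%N.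
Proof.
have /(congr1 (fun p : {poly R} => p`_k)) := mu_double n.
rewrite mulrDl mul1r -exprS !coefD !coefXn -!natrD => /eqP.
by rewrite eqr_nat => /eqP.
Qed.

Lemma mu_double_le n : (mu (2 * n) <= (mu n).+1)%N /\ (mu (2 * n).+1 <= (mu n).+1)%N.
Proof.
have := mu_double_coef n (mu (2 * n)); have := mu_double_coef n (mu (2 * n).+1).
rewrite !eqxx /=.
move: (mu (2 * n)) (mu (2 * n).+1) (mu n) => a b c; lia.
Qed.

Lemma mu_double_sum n : (mu (2 * n) + mu (2 * n).+1 = (mu n).*2.+1)%N.
Proof.
have [] := mu_double_le n.
have := mu_double_coef n (mu (2 * n)); have := mu_double_coef n (mu (2 * n).+1).
have := mu_double_coef n (mu n); have := mu_double_coef n (mu n).+1.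
by rewrite !eqxx /=; lia.
Qed.

Lemma total_onesS n : total_ones mu n.+1 = (total_ones mu n + mu n)%N.
Proof. by rewrite /total_ones big_ord_recr. Qed.

Lemma total_ones_double n : (total_ones mu (2 * n) = 2 * total_ones mu n + n)%N.
Proof.
elim: n => [|n IH]; first by rewrite /total_ones big_ord0.
have -> : (2 * n.+1 = (2 * n).+2)%N by lia.
by rewrite !total_onesS IH; have := mu_double_sum n; lia.
Qed.

Lemma excess_double l n : excess mu l.+1 (2 * n) = 2 * excess mu l n :> R.
Proof. by rewrite /excess total_ones_double natrD !natrM -(natr1 l); field. Qed.

Lemma excessS l n : excess mu l n.+1 = excess mu l n + ((mu n)%:R - l%:R / 2) :> R.
Proof. by rewrite /excess total_onesS natrD -(natr1 n); ring. Qed.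

Hypothesis mu0 : mu 0 = 0%N.

Lemma mu_le l n : (n < 2 ^ l)%N -> (mu n <= l)%N.
Proof.
elim: l n => [|l IH] n; first by case: n => // _; rewrite mu0.
move=> nl; have ln : (n./2 < 2 ^ l)%N by move: nl; rewrite expnS; lia.
have IHn := IH _ ln; have [h1 h2] := mu_double_le n./2.
have [-> | ->] : (n = (2 * n./2).+1 \/ n = 2 * n./2)%N by lia.
  exact: leq_trans h2 _.
exact: leq_trans h1 _.
Qed.

(** The factor 2 ^+ l, rather than n, turns the doubling of n into the exact
    multiplication by h. *)
Definition expansion_error (l n : nat) : {poly R} :=
  (2 ^+ l)^-1 *: (F n - n%:R *: h ^+ l - excess mu l n *: (('X - 1) * h ^+ l)).

Lemma twice_coin : 1 + 'X = 2 *: h :> {poly R}.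
Proof. by rewrite /coin scalerA mulfV// scale1r. Qed.

Lemma expansion_error_double l n : expansion_error l.+1 (2 * n) = h * expansion_error l n.
Proof.
rewrite /expansion_error F_double excess_double natrM twice_coin !exprS invfM -!mul_polyC !polyCM.
have : (2^-1)%:P * 2%:P = 1 :> {poly R} by rewrite -polyCM mulVf.
move: (2^-1)%:P 2%:P => a b ab.
have -> : forall u v w x y z : {poly R},
   a * u * (b * h * v - b * w * (h * x) - b * y * (z * (h * x))) =
   (a * b) * (h * (u * (v - w * x - y * (z * x)))).
  by move=> *; ring.
by rewrite ab mul1r.
Qed.

Lemma expansion_error_double1 l n : expansion_error l.+1 (2 * n).+1 = h * expansion_error l n +
  (2 ^+ l.+1)^-1 *: ('X^(mu (2 * n)) - h ^+ l.+1 -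
    ((mu (2 * n))%:R - l.+1%:R / 2) *: (('X - 1) * h ^+ l.+1)).
Proof.
rewrite -expansion_error_double /expansion_error gen_polyS excessS -(natr1 (2 * n)) -scalerDr.
congr (_ *: _).
by rewrite !scalerDl scale1r; ring.
Qed.

Lemma expansion_error1 : expansion_error 0 1 = 0.
Proof.
rewrite /expansion_error /excess /F /total_ones !big_ord1 mu0 !expr0 mul0r mulr0 subr0 scale0r.
by rewrite subr0 scale1r subrr scaler0.
Qed.

(** The block attached to a digit 1 at place k. Its natural denominator is
    m.+1; bounding 1 / m.+1 by k.+1 / (m + k).+1 gives all the blocks of an n
    the same denominator, since m + k is constant along its digits. *)
Lemma l1norm_block m k a : (a <= k.+1)%N ->
  l1norm (h ^+ m * ((2 ^+ k)^-1 *: ('X^a - h ^+ k - (a%:R - k%:R / 2) *: (('X - 1) * h ^+ k))))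
  <= 16 / (m + k).+1%:R * (k.+1%:R ^+ 3 / 2 ^+ k).
Proof.
move=> ak; have [S E n] := l1norm_taylor (R := R) ak.
rewrite E -scalerAr l1normZ ger0_norm ?invr_ge0 ?exprn_ge0//.
rewrite [X in _ <= X](_ : _ = (2 ^+ k)^-1 * (16 * k.+1%:R ^+ 3 / (m + k).+1%:R)); last by ring.
rewrite ler_pM2l ?invr_gt0 ?exprn_gt0//.
rewrite mulrA [h ^+ m * _]mulrC (le_trans (l1normM _ _))//.
rewrite (le_trans (ler_pM (l1norm_ge0 _) (l1norm_ge0 _) (l1norm_diff2_coinX m) n))//.
rewrite mulrAC ler_pdivrMr// mulrAC ler_pdivlMr//.
have -> : 8 * (2 * k.+1%:R ^+ 2) * (m + k).+1%:R = 16 * k.+1%:R ^+ 2 * (m + k).+1%:R :> R by ring.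
have -> : 16 * k.+1%:R ^+ 3 * m.+1%:R = 16 * k.+1%:R ^+ 2 * (k.+1 * m.+1)%:R :> R.
  by rewrite natrM; ring.
by rewrite ler_wpM2l ?mulr_ge0 ?exprn_ge0// ler_nat; lia.
Qed.

(** The factor h ^+ m is there for the induction: dropping the last digit of n
    turns l.+1 into l and m into m.+1. *)
Lemma l1norm_expansion_error_aux l n m : (2 ^ l <= n < 2 ^ l.+1)%N ->
  l1norm (h ^+ m * expansion_error l n) <= 16 / (m + l).+1%:R * cube_sum l.
Proof.
elim: l n m => [|l IH] n m ln.
  have -> : n = 1%N by move: ln; rewrite expn0 expn1; lia.
  by rewrite expansion_error1 mulr0 l1norm0 /cube_sum big_ord0 mulr0.
have ln2 : (2 ^ l <= n./2 < 2 ^ l.+1)%N by move: ln; rewrite !expnS; lia.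
have IH2 := IH _ m.+1 ln2.
have c0 : 0 <= 16 / (m + l).+2%:R :> R by [].
have t0 : 0 <= l.+2%:R ^+ 3 / 2 ^+ l.+1 :> R.
  by rewrite divr_ge0 ?exprn_ge0// addr_ge0.
rewrite cube_sumS addnS mulrDr.
have IH3 : l1norm (h ^+ m * (h * expansion_error l n./2)) <= 16 / (m + l).+2%:R * cube_sum l.
  by rewrite mulrA -exprSr -[(m + l).+1]addSn.
have [nE|nE] : (n = 2 * n./2 \/ n = (2 * n./2).+1)%N by lia.
  by rewrite nE expansion_error_double ler_wpDr// mulr_ge0.
rewrite nE expansion_error_double1 mulrDr (le_trans (l1normD _ _))// lerD//.
rewrite -[(m + l).+1]addnS l1norm_block//.
by apply: mu_le; move: ln; rewrite !expnS; lia.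
Qed.

Lemma l1norm_expansion_error l n : (2 ^ l <= n < 2 ^ l.+1)%N ->
  l1norm (expansion_error l n) <= 816 / l.+1%:R.
Proof.
move=> /(l1norm_expansion_error_aux 0); rewrite expr0 mul1r add0n => /le_trans; apply.
have -> : 816 = 16 * 51 :> R by ring.
by rewrite mulrAC ler_wpM2r ?invr_ge0// ler_wpM2l// cube_sum_le.
Qed.

(** By the triangle inequality, half the norm differs from half the norm of the
    main term by half the norm of the error; and half the norm of
    ('X - 1) * h ^+ l is mode_mass l. *)
Lemma l1norm_first_order l n : (2 ^ l <= n < 2 ^ l.+1)%N ->
  `|2^-1 * l1norm (n%:R^-1 *: F n - h ^+ l) - `|excess mu l n / n%:R| * mode_mass l|
  <= 408 / l.+1%:R.
Proof.
move=> ln; have n0 : 0 < n%:R :> R.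
  by rewrite ltr0n; case: n ln => //; rewrite leqn0 expn_eq0.
have nl : 2 ^+ l <= n%:R :> R by rewrite -natrX ler_nat; case/andP: ln.
have E : n%:R^-1 *: F n - h ^+ l =
    (excess mu l n / n%:R) *: (('X - 1) * h ^+ l) + (2 ^+ l / n%:R) *: expansion_error l n.
  rewrite /expansion_error scalerA mulrAC mulfV ?expf_neq0// mul1r !scalerBr !scalerA.
  rewrite mulVf ?gt_eqF// scale1r [_^-1 * excess _ _ _]mulrC.
  by rewrite [RHS]addrC subrK.
have e1 : l1norm ((2 ^+ l / n%:R) *: expansion_error l n) <= 816 / l.+1%:R.
  rewrite l1normZ ger0_norm ?divr_ge0 ?exprn_ge0//.
  rewrite (le_trans _ (l1norm_expansion_error ln))// ler_piMl ?l1norm_ge0//.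
  by rewrite ler_pdivrMr// mul1r.
have := l1normD ((excess mu l n / n%:R) *: (('X - 1) * h ^+ l))
  ((2 ^+ l / n%:R) *: expansion_error l n).
have := l1normB (n%:R^-1 *: F n - h ^+ l) ((2 ^+ l / n%:R) *: expansion_error l n).
rewrite -E {1}E addrK [l1norm (_ *: (_ * _))]l1normZ l1norm_diff_coinX mulrCA.
have -> : 408 / l.+1%:R = 2^-1 * (816 / l.+1%:R) :> R by field; rewrite nat1r.
move: (816 / _) (`|_ / _| * _) e1 => ? ? ? ? ?.
by rewrite ler_norml; apply/andP; split; lra.
Qed.

End Doubling.

(** * The periodic function *)

(** The intervals [u k - s k, u k + s k] are nested, so the supremum of their
    left ends belongs to all of them. *)
Lemma sup_nested {R : realType} (u s : nat -> R) :
  (forall k, 0 <= s k) -> (forall k, `|u k.+1 - u k| <= s k - s k.+1) ->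
  forall k, `|sup [set u i - s i | i in setT] - u k| <= s k.
Proof.
move=> s0 us.
have lo : {homo (fun k => u k - s k) : i j / (i <= j)%N >-> i <= j}.
  apply: homo_leq => [//|i j k|k]; first exact: le_trans.
  by have := us k; rewrite ler_norml => /andP[]; lra.
have up : {homo (fun k => - (u k + s k)) : i j / (i <= j)%N >-> i <= j}.
  apply: homo_leq => [//|i j k|k]; first exact: le_trans.
  by have := us k; rewrite ler_norml => /andP[]; lra.
have lu i j : u i - s i <= u j + s j.
  have := lo _ _ (leq_maxl i j); have := up _ _ (leq_maxr i j) => /=.
  by have := s0 (maxn i j); lra.
move=> k; set S := [set _ | _ in _].
have h1 : u k - s k <= sup S.
  apply: ub_le_sup; last by exists k.
  by exists (u k + s k) => _ [i _ <-].
have h2 : sup S <= u k + s k.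
  apply: ge_sup; first by exists (u 0%N - s 0%N); exists 0%N.
  by move=> _ [i _ <-].
by rewrite ler_norml; apply/andP; split; lra.
Qed.

(** Chosen so that consecutive values differ by k.+2 / 2 ^+ k.+1, the bound on
    a step of scaled_excess: it bounds the sum of all steps from k on. *)
Definition tail_bound {R : realType} (k : nat) : R := (k%:R + 3) / 2 ^+ k.

Lemma tail_bound_ge0 {R : realType} k : 0 <= tail_bound k :> R.
Proof. by rewrite divr_ge0 ?exprn_ge0 ?addr_ge0. Qed.

Lemma tail_boundS {R : realType} k : tail_bound k - tail_bound k.+1 = k.+2%:R / 2 ^+ k.+1 :> R.
Proof.
by rewrite /tail_bound exprS -(natr1 k.+1) -(natr1 k); field; rewrite expf_neq0.
Qed.

Lemma tail_bound_le {R : realType} k : tail_bound k <= 8 / k.+1%:R :> R.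
Proof.
rewrite ler_pdivrMr ?exprn_gt0// mulrAC ler_pdivlMr//.
have -> : (k%:R + 3) * k.+1%:R = ((k + 3) * k.+1)%:R :> R by rewrite natrM natrD.
rewrite -natrX -natrM ler_nat; elim: k => // k IH.
have := ltn_expl k (ltnSn 1); rewrite expnS; lia.
Qed.

Lemma tail_bound_small {R : realType} (e : R) : 0 < e -> exists k, tail_bound k < e.
Proof.
move=> e0; exists (Num.truncn (8 / e)).
apply: le_lt_trans (tail_bound_le _) _.
rewrite ltr_pdivrMr// mulrC -ltr_pdivrMr//.
by have /andP[] := truncn_itv (divr_ge0 (ler0n R 8) (ltW e0)).
Qed.

Definition scaled_excess {R : realType} (mu : nat -> nat) (k : nat) (t : R) : R :=
  excess mu k (Num.truncn (2 ^+ k * t)) / 2 ^+ k.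

(** The limit of scaled_excess mu k t as k grows, when 0 <= t < 2; the supremum
    is the one of sup_nested. *)
Definition excess_lim {R : realType} (mu : nat -> nat) (t : R) : R :=
  sup [set scaled_excess mu k t - tail_bound k | k in setT].

Section Limit.
Context {R : realType} (mu : nat -> nat).
Hypothesis mu0 : mu 0 = 0%N.
Hypothesis F_double : forall n, @gen_poly R mu (2 * n) = (1 + 'X) * gen_poly mu n.

Lemma truncn_lt k (t : R) : 0 <= t < 2 -> (Num.truncn (2 ^+ k * t) < 2 ^ k.+1)%N.
Proof.
move=> /andP[t0 t2].
have /andP[h _] := truncn_itv (mulr_ge0 (exprn_ge0 k (ler0n R 2)) t0).
rewrite -(ltr_nat R) (le_lt_trans h)// natrX exprSr ltr_pM2l// exprn_gt0//.
Qed.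

Lemma truncn_double (x : R) : 0 <= x ->
  Num.truncn (2 * x) = (2 * Num.truncn x)%N \/ Num.truncn (2 * x) = (2 * Num.truncn x).+1.
Proof.
move=> x0; have /andP[h1 h2] := truncn_itv x0.
have [h|h] := ltP (2 * x) (2 * Num.truncn x).+1%:R; [left|right]; apply: truncn_def.
  by rewrite h andbT natrM ler_pM2l.
rewrite h /= (_ : (2 * Num.truncn x).+2 = (2 * (Num.truncn x).+1)%N); last by lia.
by rewrite natrM ltr_pM2l.
Qed.

(** floor (2 ^+ k.+1 * t) is 2 * n or (2 * n).+1 with n = floor (2 ^+ k * t).
    The first choice does not change the scaled excess, and the second one adds
    the single term mu (2 * n) - k.+1 / 2. *)
Lemma scaled_excess_step k (t : R) : 0 <= t < 2 ->
  `|scaled_excess mu k.+1 t - scaled_excess mu k t| <= tail_bound k - tail_bound k.+1.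
Proof.
move=> t02; have t0 : 0 <= t by case/andP: t02.
have x0 : 0 <= 2 ^+ k * t by rewrite mulr_ge0 ?exprn_ge0.
have p0 : 0 < 2 ^+ k.+1 :> R by rewrite exprn_gt0.
have e2 : excess mu k (Num.truncn (2 ^+ k * t)) / 2 ^+ k =
   excess mu k.+1 (2 * Num.truncn (2 ^+ k * t)) / 2 ^+ k.+1 :> R.
  by rewrite (excess_double F_double) exprS invfM mulrACA mulfV// mul1r.
rewrite /scaled_excess e2 tail_boundS -mulrBl normrM [`|_^-1|]ger0_norm;
  last by rewrite invr_ge0 ltW.
rewrite ler_pM2r ?invr_gt0// [2 ^+ k.+1]exprS -mulrA.
have [->|->] := truncn_double x0; first by rewrite subrr normr0.
set n := Num.truncn _; rewrite excessS addrAC subrr add0r.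
have : (mu (2 * n) <= k.+2)%N.
  apply: (mu_le F_double mu0); rewrite expnS ltn_pmul2l//; exact: truncn_lt.
rewrite -(ler_nat R) => h; rewrite ler_norml.
have : 0 <= (mu (2 * n))%:R :> R by [].
have : 0 <= k%:R :> R by [].
rewrite -!(natr1 k.+1) -!(natr1 k) in h * => ? ?; apply/andP; split; lra.
Qed.

Lemma excess_lim_scaled k (t : R) : 0 <= t < 2 ->
  `|excess_lim mu t - scaled_excess mu k t| <= tail_bound k.
Proof.
by move=> t02; apply: sup_nested => *; [exact: tail_bound_ge0|exact: scaled_excess_step].
Qed.

(** The sequence is constant from k = l on, where the floors are exact. *)
Lemma excess_lim_dyadic l n : (2 ^ l <= n < 2 ^ l.+1)%N ->
  excess_lim mu (n%:R / 2 ^+ l : R) = excess mu l n / 2 ^+ l.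
Proof.
move=> ln; have p0 k : 0 < 2 ^+ k :> R by rewrite exprn_gt0.
have t02 : 0 <= (n%:R / 2 ^+ l : R) < 2.
  by rewrite divr_ge0 ?exprn_ge0//= ltr_pdivrMr// -exprS -natrX ltr_nat; case/andP: ln.
have E j : scaled_excess mu (l + j) (n%:R / 2 ^+ l : R) = excess mu l n / 2 ^+ l.
  elim: j => [|j IH].
    by rewrite addn0 /scaled_excess mulrCA mulfV ?gt_eqF// mulr1 natrK.
  rewrite -IH /scaled_excess addnS exprS.
  have -> : 2 ^+ (l + j) * (n%:R / 2 ^+ l) = (2 ^ j * n)%:R :> R.
    by rewrite exprD natrM natrX; field; rewrite gt_eqF.
  have -> : 2 * 2 ^+ (l + j) * (n%:R / 2 ^+ l) = (2 * (2 ^ j * n))%:R :> R.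
    by rewrite exprD !natrM natrX; field; rewrite gt_eqF.
  by rewrite !natrK (excess_double F_double) invfM mulrACA mulfV// mul1r.
apply/eqP; rewrite -subr_eq0 -normr_le0; apply/ler_addgt0Pl => e /tail_bound_small[k ke].
rewrite addr0 (le_trans _ (ltW ke))//.
rewrite -(E k) (le_trans (excess_lim_scaled (l + k) t02))//.
rewrite addnC; elim: l {ln t02 E} => [|l IH]; first by rewrite addn0.
rewrite (le_trans _ IH)// addnS -subr_ge0 tail_boundS divr_ge0 ?ltW//.
Qed.

(** floor (2 ^+ k * s) and floor (2 ^+ k * t) differ by at most 1. *)
Lemma scaled_excess_close k (s t : R) : 0 <= s < 2 -> 0 <= t < 2 -> s <= t ->
  t - s < (2 ^+ k)^-1 -> `|scaled_excess mu k t - scaled_excess mu k s| <= tail_bound k.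
Proof.
move=> s02 t02 st ts.
have p0 : 0 < 2 ^+ k :> R by rewrite exprn_gt0.
have s0 : 0 <= 2 ^+ k * s by rewrite mulr_ge0 ?(ltW p0)//; case/andP: s02.
have t0 : 0 <= 2 ^+ k * t by rewrite mulr_ge0 ?(ltW p0)//; case/andP: t02.
have ts1 : 2 ^+ k * t < 2 ^+ k * s + 1.
  by rewrite -ltrBlDl -mulrBr mulrC -ltr_pdivlMr// mul1r.
have st1 : 2 ^+ k * s <= 2 ^+ k * t by rewrite ler_pM2l.
rewrite /scaled_excess -mulrBl normrM [`|_^-1|]ger0_norm ?invr_ge0 ?(ltW p0)//.
rewrite ler_pM2r ?invr_gt0//.
have := truncn_lt k s02; have := truncn_itv s0; have := truncn_itv t0.
move: (Num.truncn (2 ^+ k * t)) (Num.truncn (2 ^+ k * s)) => n m /andP[n1 n2] /andP[m1 m2] mk.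
have mn : (m <= n)%N.
  by rewrite -ltnS -(ltr_nat R); lra.
have nm : (n <= m.+1)%N.
  by rewrite -ltnS -(ltr_nat R) -(natr1 m.+1); lra.
have k0 : 0 <= k%:R :> R by [].
have [->|->] : (n = m \/ n = m.+1)%N by move: mn nm; clear; lia.
  by rewrite subrr normr0 addr_ge0.
rewrite excessS addrAC subrr add0r.
have := mu_le F_double mu0 mk.
rewrite -(ler_nat R) -(natr1 k) => h; rewrite ler_norml.
have : 0 <= (mu m)%:R :> R by [].
by move=> ?; apply/andP; split; lra.
Qed.

(** A uniform limit, up to jumps of scaled_excess that are themselves at most
    tail_bound k. *)
Lemma excess_lim_continuous (t : R) : 0 < t < 2 -> {for t, continuous (excess_lim mu)}.
Proof.
move=> t02; have t02' : 0 <= t < 2 by case/andP: t02 => /ltW -> ->.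
apply/cvgrPdist_lt => e e0.
have [k ke] := tail_bound_small (divr_gt0 e0 (ltr0n R 4)).
have p0 : 0 < (2 ^+ k)^-1 :> R by rewrite invr_gt0 exprn_gt0.
near=> s.
have s02 : 0 <= s < 2.
  have : s \in `]0, 2[ by near: s; apply: near_in_itvoo; rewrite in_itv.
  by rewrite in_itv /= => /andP[/ltW -> ->].
have ts : `|t - s| < (2 ^+ k)^-1.
  by near: s; exact: cvgr_dist_lt.
have h : `|scaled_excess mu k t - scaled_excess mu k s| <= tail_bound k.
  have [st|st] := leP s t.
    by apply: scaled_excess_close => //; rewrite (le_lt_trans _ ts)// ler_norm.
  rewrite distrC; apply: scaled_excess_close => //; first exact: ltW.
  by rewrite (le_lt_trans _ ts)// distrC ler_norm.
have := excess_lim_scaled k t02'; have := excess_lim_scaled k s02.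
move: h ke; rewrite !ler_norml ltr_norml => /andP[? ?] ? /andP[? ?] /andP[? ?].
have := tail_bound_ge0 (R := R) k => ?.
by apply/andP; split; lra.
Unshelve. all: by end_near. Qed.

(** Here t = 2 ^ (x - floor x). *)
Definition Gbar (x : R) : R :=
  let t := expR ((x - (Num.floor x)%:~R) * ln 2) in excess_lim mu t / t.

Lemma Gbar_periodic x : Gbar (x + 1) = Gbar x.
Proof.
rewrite /Gbar floorDrz ?int_num1// floor1 intrD1 opprD addrACA subrr addr0 //.
Qed.

Lemma ln2_gt0 : 0 < ln 2 :> R.
Proof. by rewrite ln_gt0// ltr1n. Qed.

Lemma Gbar_continuous : {within [set x : R | x \isn't a Num.int], continuous Gbar}.
Proof.
apply: continuous_in_subspaceT => x; rewrite inE /= => xint.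
pose m : R := (Num.floor x)%:~R.
have xm : x \in `]m, (m + 1)[.
  have /andP[h1 h2] := floor_itv x; rewrite in_itv /=.
  rewrite intrD in h2; rewrite h2 andbT lt_neqAle h1 andbT.
  by move: xint; rewrite intrEfloor.
have /andP[mx xm1] : m < x < m + 1 by move: xm; rewrite in_itv.
pose t (y : R) : R := expR ((y - m) * ln 2).
have ct : {for x, continuous t}.
  apply: continuous_comp; last exact: continuous_expR.
  apply: continuousM; last exact: cst_continuous.
  apply: continuousB; [exact: cvg_id | exact: cst_continuous].
have t12 : 0 < t x < 2.
  rewrite expR_gt0 /= -[X in _ < X](@lnK _ 2) ?posrE// ltr_expR.
  by rewrite gtr_pMl ?ln2_gt0// ltrBlDl.
have : {for x, continuous (fun y => excess_lim mu (t y) / t y)}.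
  apply: continuousM.
    by apply: continuous_comp => //; exact: excess_lim_continuous.
  by apply: continuousV => //; rewrite gt_eqF ?expR_gt0.
apply: cvg_trans; apply: near_eq_cvg; near=> y.
rewrite /Gbar; suff -> : Num.floor y = Num.floor x by [].
apply: floor_def.
have : y \in `]m, (m + 1)[ by near: y; exact: near_in_itvoo.
by rewrite in_itv /= intrD => /andP[/ltW -> ->].
Unshelve. all: by end_near. Qed.

Lemma log2_nat_ge0 n : (0 < n)%N -> 0 <= log2 n%:R :> R.
Proof.
move=> n0; rewrite /log2; apply: divr_ge0; last exact: ltW ln2_gt0.
by rewrite ln_ge0// ler1n.
Qed.

Lemma floor_log2_itv n : (0 < n)%N ->
  (2 ^ floor_log2 R n <= n < 2 ^ (floor_log2 R n).+1)%N.
Proof.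
move=> n0; have l0 : 0 <= log2 n%:R :> R by exact: log2_nat_ge0.
have := truncn_itv l0; rewrite -/(floor_log2 R n) /log2.
rewrite ler_pdivlMr ?ln2_gt0// ltr_pdivrMr ?ln2_gt0//.
rewrite !mulr_natl -!lnXn// ler_ln ?ltr_ln ?posrE ?exprn_gt0 ?ltr0n//.
by rewrite -!natrX ler_nat ltr_nat.
Qed.

Lemma Gbar_log2 n : (0 < n)%N ->
  Gbar (log2 n%:R) = excess mu (floor_log2 R n) n / n%:R.
Proof.
move=> n0; set l := floor_log2 R n.
have nl := floor_log2_itv n0.
have l0 : 0 <= log2 n%:R :> R by exact: log2_nat_ge0.
rewrite /Gbar (@floor_def _ _ (l%:Z)); last first.
  by rewrite intrD /= natr1; exact: truncn_itv.
have -> : expR ((log2 n%:R - l%:R) * ln 2) = n%:R / 2 ^+ l :> R.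
  rewrite mulrBl divfK ?gt_eqF ?ln2_gt0// expRB lnK ?posrE ?ltr0n//.
  by rewrite [l%:R * _]mulr_natl -lnXn// lnK// posrE exprn_gt0.
by rewrite (excess_lim_dyadic nl) invf_div mulrA divfK// expf_neq0.
Qed.

(** At k = 0 the scaled excess vanishes, so its limit is at most tail_bound 0,
    which is 3. *)
Lemma excess_bound l n : (2 ^ l <= n < 2 ^ l.+1)%N -> `|excess mu l n / n%:R : R| <= 3.
Proof.
move=> ln; have p0 : 0 < 2 ^+ l :> R by rewrite exprn_gt0.
have /andP[l1 l2] : 1 <= (n%:R / 2 ^+ l : R) < 2.
  rewrite ler_pdivlMr// ltr_pdivrMr// mul1r -exprS -!natrX ler_nat ltr_nat //.
have := @excess_lim_scaled 0 (n%:R / 2 ^+ l).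
rewrite (excess_lim_dyadic ln) l2 (le_trans ler01 l1) => /(_ isT).
rewrite /scaled_excess expr0 divr1 mul1r (@truncn_def _ _ 1)//; last by rewrite l1.
rewrite /excess /total_ones big_ord1 mu0 mul0r mulr0 !subr0 /tail_bound expr0 add0r.
rewrite divr1 -/(excess mu l n).
have -> : excess mu l n / n%:R = excess mu l n / 2 ^+ l / (n%:R / 2 ^+ l) :> R.
  rewrite invf_div mulrA divfK// gt_eqF//.
rewrite [X in _ -> X <= _]normrM => h; rewrite -[leRHS]mulr1 ler_pM// normfV ger0_norm ?invf_le1//.
  by rewrite (lt_le_trans ltr01).
Qed.

End Limit.

(** * Laws as polynomials *)

Lemma coef_gen_poly {R : realType} (mu : nat -> nat) n k :
  (gen_poly mu n : {poly R})`_k = \sum_(j < n) (mu j == k)%:R.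
Proof. by rewrite coef_sum; apply: eq_bigr => j _; rewrite coefXn eq_sym. Qed.

Lemma mnormalizeE d (T : measurableType d) (R : realType)
    (m : {measure set T -> \bar R}) (P : probability T R) (c : R) (A : set T) :
  c != 0 -> m [set: T] = c%:E -> mnormalize m P A = (m A * c^-1%:E)%E.
Proof. by move=> c0 mT; rewrite /mnormalize mT eqe (negbTE c0). Qed.

Lemma msum_dirac {R : realType} n (A : set nat) :
  msum (fun j => \d_j : {measure set nat -> \bar R}) n A =
  (\sum_(j < n) (val j \in A)%:R)%:E.
Proof. by rewrite /msum -sumEFin; apply: eq_bigr => j _ /=; rewrite diracE. Qed.

Lemma unifE {R : realType} n (A : set nat) : (0 < n)%N ->
  unif R n A = ((\sum_(j < n) (val j \in A)%:R) / n%:R)%:E.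
Proof.
move=> n0; rewrite EFinM -msum_dirac; apply: mnormalizeE.
  by rewrite pnatr_eq0 -lt0n.
rewrite [LHS]msum_dirac (eq_bigr (fun=> 1)); last by move=> j _; rewrite in_setT.
by rewrite sumr_const card_ord.
Qed.

Lemma lawZ_mass {R : realType} enc n k : (0 < n)%N ->
  lawZ R enc n [set k] = ((n%:R^-1 *: gen_poly (num_ones enc) n)`_k)%:E.
Proof.
move=> n0; rewrite /lawZ /distribution /pushforward [LHS]unifE// coefZ coef_gen_poly mulrC.
congr ((_ * _)%:E); apply: eq_bigr => j _; congr (nat_of_bool _)%:R.
by apply/idP/eqP; rewrite inE.
Qed.

Lemma binomial_mass {R : realType} l k :
  binomial_prob l (2^-1 : R) [set k] = (((@coin R) ^+ l)`_k)%:E.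
Proof.
have h2 : 0 <= (2^-1 : R) <= 1 by apply/andP; split; lra.
rewrite /binomial_prob h2 esum_set1 ?lee_fin ?binomial_pmf_ge0//.
rewrite coef_coinX /binomial_pmf /unstable.onem; congr _%:E.
have -> : 1 - 2^-1 = 2^-1 :> R by lra.
have [kl|lk] := leqP k l; last by rewrite bin_small// mul0r.
by rewrite -exprD subnKC// exprVn mulr_natl.
Qed.

(** Adding an independent fair bit multiplies the generating polynomial by
    (1 + 'X) / 2: the event that the sum is k.+1 splits into the rectangles
    (k.+1, 0) and (k, 1). *)
Lemma add_bernoulli_mass {R : realType} (P : probability nat R) (p : {poly R}) k :
  (forall i, P [set i] = (p`_i)%:E) ->
  add_bernoulli P [set k] = (((2^-1) *: ((1 + 'X) * p))`_k)%:E.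
Proof.
move=> Pp; rewrite /add_bernoulli /distribution /pushforward.
have bE b : bernoulli_prob (2^-1 : R) [set b] = (2^-1)%:E.
  rewrite bernoulli_probE; last by apply/andP; split; lra.
  rewrite /unstable.onem (_ : 1 - 2^-1 = 2^-1); last by lra.
  rewrite !diracE; case: b.
    by rewrite mem_set// memNset//= mule0 adde0 mule1.
  by rewrite memNset// mem_set//= mule0 add0e mule1.
have rE i b : (P \x bernoulli_prob (2^-1 : R))%E ([set i] `*` [set b]) = (p`_i / 2)%:E.
  by rewrite product_measure1E// EFinM; congr (_ * _)%E; [exact: Pp|exact: bE].
rewrite coefZ mulrDl mul1r coefD coefXM.
case: k => [|k] /=.
  rewrite (_ : _ @^-1` _ = [set 0%N] `*` [set false]).
    by rewrite rE /= addr0 mulrC.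
  apply/seteqP; split => [[i b] /=|[i b] /= [-> ->]//].
  by rewrite /sum_bool /=; case: b; case: i.
rewrite (_ : _ @^-1` _ = ([set k.+1] `*` [set false]) `|` ([set k] `*` [set true])).
  rewrite measureU.
  - transitivity ((p`_k.+1 / 2)%:E + (p`_k / 2)%:E)%E.
      by congr (_ + _)%E; exact: rE.
    by rewrite -EFinD; congr _%:E; ring.
  - exact: measurableX.
  - exact: measurableX.
  - by apply/seteqP; split => // -[i b] /= [[_ ->] [_]].
apply/seteqP; split => [[i b] /=|[i b] /= [[-> ->]|[-> ->]]]; rewrite /sum_bool /=.
- by case: b => /= e; [right|left]; split => //; lia.
- by rewrite addn0.
- by rewrite addn1.
Qed.

Lemma gen_poly_double {R : realType} (enc : nat -> seq bool) :
  (forall n : nat, (1 <= n)%N -> lawZ R enc (2 * n) =1 add_bernoulli (lawZ R enc n)) ->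
  forall n, @gen_poly R (num_ones enc) (2 * n) = (1 + 'X) * gen_poly (num_ones enc) n.
Proof.
move=> H [|n]; first by rewrite muln0 /gen_poly big_ord0 mulr0.
apply/polyP => k; have := H n.+1 isT [set k].
rewrite (add_bernoulli_mass _ (fun i => lawZ_mass enc i (ltn0Sn n))) lawZ_mass ?muln_gt0//.
move=> [] /(congr1 (fun x => (2 * n.+1)%:R * x)).
rewrite -scalerAr scalerA -invfM -natrM !coefZ !mulVKf//.
Qed.

Lemma dTV_l1norm {R : realType} (P Q : probability nat R) (p q : {poly R}) :
  (forall k, P [set k] = (p`_k)%:E) -> (forall k, Q [set k] = (q`_k)%:E) ->
  dTV P Q = 2^-1 * l1norm (p - q).
Proof.
move=> Pp Qq; rewrite /dTV; congr (_ * _).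
have E k : (`|P [set k] - Q [set k]|)%E = (`|(p - q)`_k|)%:E.
  by rewrite Pp Qq coefB.
rewrite (eq_eseriesr (fun k _ => E k)) (@nneseries_split _ _ 0 (size (p - q)))//.
rewrite add0n eseries0 ?adde0; last first.
  by move=> k ks _; rewrite nth_default// normr0.
by rewrite sumEFin/= big_mkord (l1normE (leqnn _)).
Qed.

Lemma expectation_unif {R : realType} (mu : nat -> nat) n : (0 < n)%N ->
  ('E_(unif R n)[fun j => (mu j)%:R] = ((total_ones mu n)%:R / n%:R)%:E)%E.
Proof.
move=> n0; rewrite unlock.
have ninv : 0 <= (n%:R^-1 : R) by rewrite invr_ge0.
pose m : {measure set nat -> \bar R} :=
  mscale (NngNum ninv) (msum (fun j => \d_j : {measure set nat -> \bar R}) n).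
rewrite (@eq_measure_integral _ _ _ _ m); last first.
  by move=> A _ _; rewrite [LHS]unifE// EFinM -msum_dirac muleC.
rewrite ge0_integral_mscale//= ge0_integral_measure_sum//=.
rewrite /total_ones natr_sum EFinM muleC -sumEFin; congr (_ * _)%E.
by apply: eq_bigr => j _; rewrite integral_dirac// diracT mul1e.
Qed.

(** * Conclusion *)

(** (x - y)^2 <= |x - y| (x + y) for nonnegative x and y. *)
Lemma normB_sqr_le {R : realDomainType} (x y c : R) : 0 <= x -> 0 <= y -> 0 <= c ->
  `|x ^+ 2 - y ^+ 2| <= c ^+ 2 -> `|x - y| <= c.
Proof.
move=> x0 y0 c0 h; rewrite -ler_sqr ?nnegrE// (le_trans _ h)//.
rewrite subr_sqr normrM expr2 ler_wpM2l// (le_trans (ler_normB _ _))//.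
by rewrite [leRHS]ger0_norm ?addr_ge0// !ger0_norm.
Qed.

(** Multiplied by pi, the squares of both numbers lie between 2 / (l + 2) and
    2 / l. *)
Lemma mode_mass_asymp {R : realType} (l : nat) (L : R) : (0 < l)%N -> l%:R <= L <= l%:R + 2 ->
  `|mode_mass l - Num.sqrt 2 / Num.sqrt (pi * L)| <= 2 / l%:R.
Proof.
move=> l0 /andP[lL Ll]; have p1 : 1 <= pi :> R by rewrite (le_trans _ (pi_ge2 R))// ler1n.
have p0 : 0 < pi :> R by exact: pi_gt0.
have l0' : 0 < l%:R :> R by rewrite ltr0n.
have L0 : 0 < L by exact: lt_le_trans lL.
apply: normB_sqr_le; rewrite ?mode_mass_ge0 ?divr_ge0 ?sqrtr_ge0//.
rewrite [X in _ - X]expr_div_n !sqr_sqrtr//; last by rewrite mulr_ge0 ?ltW.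
have := mode_mass_lb (R := R) l; have := mode_mass_ub (R := R) l.
set B := mode_mass l ^+ 2; set V := 2 / (pi * L) => ub lb.
have LV : pi * L * V = 2 by rewrite /V mulrC divfK// gt_eqF// mulr_gt0.
have V0 : 0 <= pi * V by rewrite !mulr_ge0 ?invr_ge0 ?mulr_ge0 ?ltW.
have B0 : 0 <= pi * B by rewrite mulr_ge0 ?sqr_ge0// ltW.
have h1 := ler_wpM2r V0 lL; have h2 := ler_wpM2r V0 Ll.
have h3 : `|pi * B - pi * V| <= (2 / l%:R) ^+ 2.
  rewrite expr_div_n ler_pdivlMr ?exprn_gt0//.
  rewrite -[_ ^+ 2]ger0_norm ?sqr_ge0// -normrM ler_norml.
  have k1 : l%:R * (l%:R * (pi * B)) <= l%:R * 2 by rewrite ler_pM2l//; lra.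
  have k2 : l%:R * (l%:R * (pi * V)) <= l%:R * 2 by rewrite ler_pM2l//; lra.
  have k3 : l%:R * 2 <= l%:R * ((l%:R + 2) * (pi * B)) by rewrite ler_pM2l//; lra.
  have k4 : l%:R * 2 <= l%:R * ((l%:R + 2) * (pi * V)) by rewrite ler_pM2l//; lra.
  by apply/andP; split; lra.
rewrite (le_trans _ h3)// -mulrBr normrM [`|pi|]gtr0_norm// ler_peMl//.
Qed.

Theorem corollary4p3 (R : realType) (enc : nat -> seq bool)
    (enc_inj : injective enc)
    (enc0 : num_ones enc 0 = 0%N)
    (Z_double : forall n : nat, (1 <= n)%N ->
       lawZ R enc (2 * n) =1 add_bernoulli (lawZ R enc n)) :
  exists G : R -> R,
    [/\ forall x : R, G (x + 1) = G x,
        {within [set x : R | x \isn't a Num.int], continuous G},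
        forall n : nat, (1 <= n)%N ->
          (G (log2 n%:R))%:E =
          ('E_(unif R n)[fun j => (num_ones enc j)%:R] - ((floor_log2 R n)%:R / 2)%:E)%E
      & (fun n : nat =>
           dTV (lawZ R enc n) (binomial_prob (floor_log2 R n) (2^-1 : R))
           - Num.sqrt 2 * `|G (log2 n%:R)| / Num.sqrt (pi * log2 n%:R))
        =O_\oo (fun n : nat => (ln n%:R)^-1 : R)].
Proof.
have F_double := gen_poly_double Z_double.
exists (@Gbar R (num_ones enc)); split.
- exact: Gbar_periodic.
- exact: (Gbar_continuous enc0 F_double).
- move=> n n0; rewrite (Gbar_log2 enc0 F_double n0) expectation_unif// -EFinB.
  rewrite /excess mulrBl [_%:R * (_ / 2)]mulrC mulfK// pnatr_eq0 -lt0n//.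
apply/eqO_exP.
(* 420 = 408 + 3 * 4: the error of the expansion, and the bound 3 on the function
   times the error 4 / log2 n on the largest weight; ln 2 converts log2 to ln. *)
exists (420 * ln 2).
  by apply: mulr_gt0 ln2_gt0; rewrite ltr0n.
near=> n.
have n2 : (2 <= n)%N by near: n; exact: nbhs_infty_ge.
have n0 : (0 < n)%N by exact: ltnW.
rewrite (Gbar_log2 enc0 F_double n0).
rewrite (dTV_l1norm (fun k => lawZ_mass enc k n0) (binomial_mass _)).
have nl := floor_log2_itv (R := R) n0.
have := l1norm_first_order F_double enc0 nl.
have := excess_bound enc0 F_double nl.
have : (floor_log2 R n)%:R <= log2 (n%:R : R) < (floor_log2 R n).+1%:R.
  exact/truncn_itv/log2_nat_ge0.
set L := log2 n%:R; set l := floor_log2 R n in nl *.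
have l0 : (0 < l)%N.
  by rewrite lt0n; apply/eqP => l0; move: nl; rewrite l0 => /andP[_]; rewrite ltnNge n2.
set g := `|_ / _|; set d := 2^-1 * _.
move=> /andP[lL Ll1] g3 dg.
have L0 : 0 < L by rewrite (lt_le_trans _ lL)// ltr0n.
have bL : `|mode_mass l - Num.sqrt 2 / Num.sqrt (pi * L)| <= 2 / l%:R.
  by apply: mode_mass_asymp => //; rewrite lL /=; move: Ll1; rewrite -natr1; lra.
have -> : `|(ln n%:R)^-1 : R| = (L * ln 2)^-1.
  have lnn : ln n%:R = L * ln 2 by rewrite /L /log2 divfK// gt_eqF// ln2_gt0.
  by rewrite lnn ger0_norm// invr_ge0 mulr_ge0 ?ltW// ln2_gt0.
have -> : 420 * ln 2 / (L * ln 2) = 420 / L.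
  by field; rewrite gt_eqF//= gt_eqF// ln2_gt0.
have -> : d - Num.sqrt 2 * g / Num.sqrt (pi * L) =
  (d - g * mode_mass l) + g * (mode_mass l - Num.sqrt 2 / Num.sqrt (pi * L)) by ring.
rewrite (le_trans (ler_normD _ _))// normrM.
have h1 : 408 / l.+1%:R <= 408 / L.
  by rewrite ler_pM2l ?ltr0n// lef_pV2 ?posrE// ltW.
have h2 : 2 / l%:R <= 4 / L :> R.
  rewrite ler_pdivrMr ?ltr0n// mulrAC ler_pdivlMr//.
  have : 1 <= l%:R :> R by rewrite ler1n.
  by move: Ll1; rewrite -natr1; lra.
have h3 : `|g| * `|mode_mass l - Num.sqrt 2 / Num.sqrt (pi * L)| <= 3 * (4 / L).
  by apply: ler_pM => //; [rewrite /g normr_id | exact: le_trans bL h2].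
have -> : 420 / L = 408 / L + 3 * (4 / L) by ring.
by rewrite lerD// (le_trans dg).
Unshelve. all: by end_near. Qed.
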